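(* Let $(X,d)$ be an Atsuji space. Then for each decreasing sequence $\{K_n\}_{n\ge 1}$ of nonempty closed bounded subsets of $X$ with $H(K_n,K_{n+1})\to 0$ as $n\to\infty$, one has $\bigcap_{n=1}^{\infty} K_n\neq\emptyset$.
   Context: A metric space $(X,d)$ is an Atsuji space if the set $X'$ of limit (accumulation) points of $X$ is compact and, for each $\epsilon>0$, the complement in $X$ of $N_\epsilon(X'):=\bigcup_{x\in X'}B(x,\epsilon)$ is uniformly discrete (i.e. there is $\eta>0$ such that any two distinct points of it are at distance at least $\eta$); here $B(x,\epsilon)$ is the open ball of center $x$ and radius $\epsilon$. A sequence $\{K_n\}$ of subsets of $X$ is decreasing if $K_{n+1}\subset K_n$ for all $n\in\mathbb N$ (not necessarily strictly). For nonempty $A,B\subset X$, the Hausdorff distance is $H(A,B)=\max\{\sup_{x\in A} d(x,B),\ \sup_{x\in B} d(x,A)\}$, where $d(x,A)=\inf_{y\in A} d(x,y)$. *)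

(* Defs.v *)
From HB Require Import structures.
From mathcomp Require Import all_boot all_order all_algebra.
From mathcomp Require Import all_classical all_reals all_analysis.
Set Implicit Arguments.
Unset Strict Implicit.
Unset Printing Implicit Defensive.
Import Order.TTheory GRing.Theory Num.Theory.
Import numFieldNormedType.Exports.
Local Open Scope classical_set_scope.
Local Open Scope ring_scope.

Definition uniformly_discrete (R : realType) (X : metricType R) (A : set X) :
    Prop :=
  exists2 eta : R, 0 < eta &
    forall x y : X, A x -> A y -> x <> y -> eta <= mdist x y.

Definition enlargement (R : realType) (X : metricType R) (e : R) (A : set X) :
    set X :=
  \bigcup_(x in A) ball x e.

Definition Atsuji_space (R : realType) (X : metricType R) : Prop :=
  compact (limit_point [set: X]) /\
  forall e : R, 0 < e ->
    uniformly_discrete (~` enlargement e (limit_point [set: X])).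

(* [bounded_set] from the library is restricted to normed spaces. *)
Definition metric_bounded (R : realType) (X : metricType R) (A : set X) :
    Prop :=
  exists M : R, forall x y : X, A x -> A y -> mdist x y <= M.

(* Meaningful for nonempty [A] only: the real [inf] of [set0] is [0]. *)
Definition dist_to_set (R : realType) (X : metricType R) (x : X) (A : set X) :
    R :=
  inf [set mdist x y | y in A].

(* Extended-real valued, so that it is infinite, and not a junk real value,
   when one of the suprema is; meaningful for nonempty sets only. *)
Definition hausdorff_dist (R : realType) (X : metricType R) (A B : set X) :
    \bar R :=
  maxe (ereal_sup [set (dist_to_set x B)%:E | x in A])
       (ereal_sup [set (dist_to_set x A)%:E | x in B]).

(* Main.v *)
Require Import Defs.
From HB Require Import structures.
From mathcomp Require Import all_boot all_order all_algebra.
From mathcomp Require Import all_classical all_reals all_analysis.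
Import Order.TTheory GRing.Theory Num.Theory.
Import numFieldNormedType.Exports.
Local Open Scope classical_set_scope.
Local Open Scope ring_scope.

(** Either every [K n] comes arbitrarily close to the set X' of limit points,
    and then points of X' ever closer to [K n] cluster, by compactness, at a
    point of every [K n]; or some [K m] avoids a whole enlargement of X', so it
    is uniformly discrete, and then [K n = K n.+1] as soon as their Hausdorff
    distance drops below the separation constant. *)

(** A strict upper bound on an infimum is beaten by some element of the set; nonemptiness of [B]
    rules out the default value [0] of [inf] on the empty set. *)
Lemma hausdorff_dist_lt (R : realType) (X : metricType R) (A B : set X)
    (e : R) (x : X) :
  B !=set0 -> (hausdorff_dist A B < e%:E)%E -> A x ->
  exists2 y, B y & mdist x y < e.
Proof.
move=> [b Bb] + Ax; rewrite /hausdorff_dist gt_max => /andP[supe _].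
have distE :
    ((dist_to_set x B)%:E <= ereal_sup [set (dist_to_set z B)%:E | z in A])%E.
  by apply: ereal_sup_ubound; exists x.
have := le_lt_trans distE supe; rewrite lte_fin.
move=> /inf_lt; case; first by exists (mdist x b); exists b.
by move=> _ [y By <-] xy; exists y.
Qed.

Lemma bigcap_compact_enlargement (R : realType) (X : metricType R) (C : set X)
    (K : nat -> set X) :
  compact C -> (forall n, closed (K n)) ->
  (forall m n, (m <= n)%N -> K n `<=` K m) ->
  (forall n e, 0 < e -> K n `&` enlargement e C !=set0) ->
  \bigcap_n K n !=set0.
Proof.
move=> cptC Kcl Kdecr meet.
have /choice[c cP] n : exists c, C c /\ exists2 x, K n x & ball c n.+1%:R^-1 x.
  have [|x [Knx [c Cc cx]]] := meet n n.+1%:R^-1; first by rewrite invr_gt0.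
  by exists c; split => //; exists x.
have cC : (c @ \oo) C by exists 0%N => // n _; case: (cP n).
have [p [_ clp]] := cptC (c @ \oo) _ cC.
(* As [K m] is closed, it suffices that every ball around [p] meets it. *)
exists p => m _; apply: Kcl => U /nbhs_ballP[e /= e0 peU].
have e20 : 0 < e / 2 by rewrite divr_gt0.
(* Clustering only yields a value of [c] near [p]; this set also records an index [n] of that value,
   large enough that [K n] lies in [K m] and that [c n] is within [e / 2] of a point of [K n]. *)
have near_c : (c @ \oo) [set z | exists n, [/\ (m <= n)%N, c n = z &
    n.+1%:R^-1 < e / 2]].
  suff : \forall n \near \oo, (m <= n)%N /\ n.+1%:R^-1 < e / 2.
    by apply: filterS => n [mn ne]; exists n.
  near=> n; split; near: n; first exact: nbhs_infty_ge.
  exact: (near_infty_natSinv_lt (PosNum e20)).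
have [_ [[n [mn <- ne]] pcn]] := clp _ _ near_c (nbhsx_ballx p _ e20).
have [_ [x Knx cnx]] := cP n.
exists x; split; first exact: Kdecr Knx.
apply: peU; apply: (ball_split pcn); exact: le_ball (ltW ne) _ cnx.
Unshelve. all: by end_near.
Qed.

Theorem theorem3p7 (R : realType) (X : metricType R) (hX : Atsuji_space X)
    (K : nat -> set X)
    (K_nonempty : forall n : nat, K n !=set0)
    (K_closed : forall n : nat, closed (K n))
    (K_bounded : forall n : nat, metric_bounded (K n))
    (K_decreasing : forall n : nat, K n.+1 `<=` K n)
    (K_hausdorff :
      (fun n : nat => hausdorff_dist (K n) (K n.+1)) @ \oo --> (0 : \bar R)%E) :
  \bigcap_n K n !=set0.
Proof.
have Kdecr m n : (m <= n)%N -> K n `<=` K m.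
  apply: (homo_leq (r := fun A B : set X => B `<=` A)) => // [A|].
    exact: subset_refl.
  move=> B A C BA CB; exact: subset_trans CB BA.
case: hX => cptX' discrX'.
have [meet|] := pselect
    (forall n e, 0 < e -> K n `&` enlargement e (limit_point [set: X]) !=set0).
  exact: bigcap_compact_enlargement cptX' K_closed Kdecr meet.
move=> /existsNP[m /existsNP[e /not_implyP[e0 Kme]]].
have [eta eta0 sep] := discrX' e e0.
have Kdiscr n x : (m <= n)%N -> K n x ->
    (~` enlargement e (limit_point [set: X])) x.
  by move=> mn Knx X'x; apply: Kme; exists x; split => //; exact: Kdecr Knx.
have [N _ HN] : \forall n \near \oo, (hausdorff_dist (K n) (K n.+1) < eta%:E)%E.
  apply: (K_hausdorff [set u | (u < eta%:E)%E]).
  by apply: open_ereal_lt'; rewrite lte_fin.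
(* Past [m] points are [eta]-separated, past [N] each has a point of the next set closer than [eta]:
   that point can only be itself. *)
have Kstable n x : (maxn m N <= n)%N -> K n x -> K n.+1 x.
  rewrite geq_max => /andP[mn Nn] Knx.
  have [y Ky xy] : exists2 y, K n.+1 y & mdist x y < eta.
    exact: hausdorff_dist_lt (K_nonempty n.+1) (HN n Nn) Knx.
  have [-> //|/eqP neq] := eqVneq x y.
  have := sep x y (Kdiscr _ _ mn Knx) (Kdiscr _ _ (leqW mn) Ky) neq.
  by rewrite leNgt xy.
have [x Kx] := K_nonempty (maxn m N).
have Kxk k : K (maxn m N + k)%N x.
  by elim: k => [|k IH]; rewrite ?addn0// addnS; apply: Kstable; rewrite ?leq_addr.
(* The index [maxn m N + k] with [k = n] is at least [n], so this also covers the sets before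
   stabilization. *)
by exists x => n _; apply: Kdecr (Kxk n); exact: leq_addl.
Qed.
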